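(* Let $n\ge 4$ and let $A_n$ be the complex $(n-1)$-ary Filippov algebra with basis $e_1,\dots,e_n$ and totally antisymmetric multilinear product determined by $[e_1,\dots,\hat e_i,\dots,e_n]=(-1)^{n+i}e_i$ for $i=1,\dots,n$. Then every local derivation of $A_n$ is a derivation of $A_n$.
   Context: The base field is $\mathbb{C}$. An $m$-ary algebra is a vector space with an $m$-linear operation $[\cdot,\dots,\cdot]$. The symbol $\hat e_i$ means that $e_i$ is omitted from the product. ''Antisymmetric'' means that the product changes sign under transposition of any two arguments, so it vanishes if two arguments coincide. A Filippov algebra is an algebra with one antisymmetric $m$-ary operation satisfying $[[x_1,\dots,x_m],y_2,\dots,y_m]=\sum_{i=1}^m[x_1,\dots,[x_i,y_2,\dots,y_m],\dots,x_m]$. (The algebra $A_n$ is one, with $m=n-1$.) A derivation of an $m$-ary algebra $\mathbf{A}$ is a linear map $D:\mathbf{A}\to\mathbf{A}$ with $D([x_1,\dots,x_m])=\sum_{i=1}^m[x_1,\dots,D(x_i),\dots,x_m]$ for all $x_1,\dots,x_m\in\mathbf{A}$. A local derivation of $\mathbf{A}$ is a linear map $\nabla:\mathbf{A}\to\mathbf{A}$ such that for every $x\in\mathbf{A}$ there exists a derivation $D_x$ of $\mathbf{A}$ (depending on $x$) with $\nabla(x)=D_x(x)$. *)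

(* Defs.v *)
From mathcomp Require Import all_boot all_order all_algebra all_fingroup.
From mathcomp Require Import reals complex.

Set Implicit Arguments.
Unset Strict Implicit.
Unset Printing Implicit Defensive.

Import GRing.Theory.
Local Open Scope ring_scope.

Section MaryAlgebra.
Variables (K : fieldType) (V : lmodType K) (m : nat).
Implicit Types (mu : {ffun 'I_m -> V} -> V) (x : {ffun 'I_m -> V}).

Definition set_arg x (i : 'I_m) (v : V) : {ffun 'I_m -> V} :=
  [ffun j => if j == i then v else x j].

Definition multilinear_op mu : Prop :=
  forall x (i : 'I_m), linear (fun v : V => mu (set_arg x i v)).

Definition antisymmetric_op mu : Prop :=
  forall x (i j : 'I_m), i != j ->
    mu [ffun k => x (tperm i j k)] = - mu x.

Definition derivation mu (D : {linear V -> V}) : Prop :=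
  forall x, D (mu x) = \sum_(i < m) mu (set_arg x i (D (x i))).

Definition local_derivation mu (N : {linear V -> V}) : Prop :=
  forall v : V, exists2 D : {linear V -> V}, derivation mu D & N v = D v.

End MaryAlgebra.

(* [mu] is the product of A_n in the basis [e]. Indices start at 0, so the
   exponent [n + i] of the 1-based multiplication table becomes [n + i.+1];
   [lift i] enumerates, in increasing order, the indices other than [i].
   Over a field of characteristic other than 2 these conditions determine
   [mu] and imply the Filippov identity, which is not required separately. *)
Definition A_product (K : fieldType) (V : vectType K) (n : nat)
    (e : n.-tuple V) (mu : {ffun 'I_n.-1 -> V} -> V) : Prop :=
  [/\ basis_of {:V} e,
      multilinear_op mu,
      antisymmetric_op mu
    & forall i : 'I_n,
        mu [ffun j => tnth e (lift i j)] = (-1) ^+ (n + i.+1) *: tnth e i].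

(* Main.v *)
Require Import Defs.
From mathcomp Require Import all_boot all_order all_algebra all_fingroup.
From mathcomp Require Import reals complex ring.
From mathcomp Require Import ring.

(** The product of A_n is the generalized cross product.  For the symmetric
    bilinear form [dot e] that makes [e] orthonormal, [mu x] is the vector with
      dot (mu x) y = det (x_1, ..., x_(n-1), y)          for all y,
    the determinant being that of the coordinates in [e] ([dot_mu]).

    The derivations are therefore the maps that are skew for this form.  For
    every endomorphism D, applying D to one row of a determinant at a time and
    adding up multiplies the determinant by tr D ([sum_det_mulrow]).  The terms
    where D hits an x_i make up the right-hand side of the Leibniz rule, so this
    rule says exactly that
      dot (D z) y + dot z (D y) = tr D * dot z y
    for every z = mu x, hence for every z, since the products mu x include the
    basis vectors up to sign.  The choice y = z = e_i and summation over i give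
    2 tr D = n tr D, so that tr D = 0 as n <> 2, and D is skew.  Conversely a
    skew map has trace 0 and satisfies the displayed identity
    ([derivation_dotP]).

    Skewness amounts to dot (D x) x = 0 for all x, a condition that involves the
    value of D at one vector at a time.  A local derivation agrees at each x
    with some derivation, so it satisfies this condition too, and is a
    derivation. *)

Set Implicit Arguments.
Unset Strict Implicit.
Unset Printing Implicit Defensive.

Import GRing.Theory.
Local Open Scope ring_scope.

(** * A trace identity for determinants *)

(** Expanding the [i]-th determinant along row [i] gives the diagonal entry
    [(A *m B *m \adj A) i i]; the sum is the trace of that product, which is
    invariant under cyclic permutation of the factors. *)
Lemma sum_det_mulrow (K : comNzRingType) (n : nat) (A B : 'M[K]_n) :
  \sum_i \det (\matrix_(a, b) (if a == i then (A *m B) a b else A a b))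
  = \tr B * \det A.
Proof.
transitivity (\tr (A *m B *m \adj A)).
  apply: eq_bigr => i _.
  rewrite (expand_det_row _ i) !mxE; apply: eq_bigr => j _.
  rewrite ![in RHS]mxE !mxE eqxx; congr (_ * _).
  rewrite /cofactor; congr (_ * \det _); apply/matrixP => a b.
  by rewrite !mxE eq_sym (negbTE (neq_lift _ _)).
by rewrite mxtrace_mulC mulmxA mul_adj_mx mul_scalar_mx mxtraceZ mulrC.
Qed.

(** * Alternating forms of codegree one *)

Section AlternatingForms.
Variables (K : fieldType) (V : vectType K) (k : nat) (e : k.+1.-tuple V).
Hypotheses (two_neq0 : (2%:R : K) != 0) (basis_e : basis_of {:V} e).

Lemma sum_coord_basis v : v = \sum_j coord e j v *: tnth e j.
Proof.
rewrite {1}(coord_basis basis_e (memvf v)).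
by apply: eq_bigr => j _; rewrite (tnth_nth 0).
Qed.

Lemma coord_tnth i j : coord e j (tnth e i) = (i == j)%:R.
Proof. by rewrite (tnth_nth 0) coord_free ?(basis_free basis_e) // eq_sym. Qed.

Variable F : {ffun 'I_k -> V} -> K.
Hypothesis F_lin : forall x i a u v,
  F (set_arg x i (a *: u + v)) = a * F (set_arg x i u) + F (set_arg x i v).
Hypothesis F_anti : forall (x : {ffun 'I_k -> V}) (i j : 'I_k), i != j ->
  F [ffun l => x (tperm i j l)] = - F x.

Lemma alternating_perm_eq0 (s : {perm 'I_k}) (x : {ffun 'I_k -> V}) :
  F x = 0 -> F [ffun l => x (s l)] = 0.
Proof.
have [ts -> Hts] := prod_tpermP s.
elim: ts Hts x => [|t ts IH] /= Hts x Fx.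
  by rewrite big_nil -[RHS]Fx; congr F; apply/ffunP => l; rewrite ffunE perm1.
case/andP: Hts => Ht Hts; rewrite big_cons.
set p := (\prod_(_ <- ts) _)%g.
have -> : [ffun l => x ((tperm t.1 t.2 * p)%g l)] =
          [ffun l => [ffun l => x (p l)] (tperm t.1 t.2 l)].
  by apply/ffunP => l; rewrite !ffunE permM.
by rewrite F_anti // (IH Hts _ Fx) oppr0.
Qed.

Lemma multilinear_sum_arg x i (I : finType) (a : I -> K) (u : I -> V) :
  F (set_arg x i (\sum_l a l *: u l)) = \sum_l a l * F (set_arg x i (u l)).
Proof.
have F0 : F (set_arg x i 0) = 0.
  have := F_lin x i 1 0 0; rewrite scaler0 addr0 mul1r => /eqP.
  by rewrite -subr_eq subrr => /eqP.
elim/big_rec2: _ => [|l s v _ <-] //; exact: F_lin.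
Qed.

Hypothesis F_lift : forall c : 'I_k.+1, F [ffun j => tnth e (lift c j)] = 0.

Lemma alternating_basis_eq0 (f : 'I_k -> 'I_k.+1) : F [ffun j => tnth e (f j)] = 0.
Proof.
have [/injectiveP f_inj | /injectivePn [i [j ij fij]]] := boolP (injectiveb f).
  (* [f] misses an index [c], so it is a permutation followed by [lift c]. *)
  have [c cP] : exists c, c \notin codom f.
    apply/existsP; rewrite -negb_forall; apply/negP => /forallP fsurj.
    have : (#|'I_k.+1| <= #|codom f|)%N.
      by apply/subset_leq_card/subsetP => c _; apply: fsurj.
    by rewrite card_codom // !card_ord ltnn.
  have cf j : c != f j by apply: contraNneq cP => ->; apply: codom_f.
  have [g gP] : exists g : 'I_k -> 'I_k, forall j, f j = lift c (g j).
    apply: (@fin_all_exists _ (fun=> _) (fun j i => f j = lift c i)) => j.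
    by have [i fj _] := unlift_some (cf j); exists i.
  have g_inj : injective g.
    by move=> i j gij; apply: f_inj; rewrite !gP gij.
  rewrite -[RHS](alternating_perm_eq0 (perm g_inj) (F_lift c)).
  by congr F; apply/ffunP => j; rewrite !ffunE permE gP.
have := F_anti [ffun j => tnth e (f j)] ij.
have -> : [ffun l => [ffun j => tnth e (f j)] (tperm i j l)]
          = [ffun j => tnth e (f j)].
  by apply/ffunP => l; rewrite !ffunE; case: tpermP => // ->; rewrite fij.
move/eqP; rewrite -addr_eq0 -mulr2n -mulr_natl mulf_eq0 (negbTE two_neq0).
by move/eqP.
Qed.

(** In dimension [k.+1], an alternating [k]-form has one coordinate for each
    omitted basis vector, and [F_lift] says that all of them vanish. *)
Lemma alternating_eq0 x : F x = 0.
Proof.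
(* The arguments are replaced by basis vectors one position at a time: those
   of index at least [m] are already basis vectors. *)
suff P (m : nat) (y : {ffun 'I_k -> V}) :
    (forall i : 'I_k, (m <= i)%N -> exists c, y i = tnth e c) -> F y = 0.
  by apply: (P k) => i; rewrite leqNgt ltn_ord.
elim: m y => [|m IH] y Hy.
  have [f fP] := fin_all_exists (fun i => Hy i isT).
  rewrite -[RHS](alternating_basis_eq0 f); congr F; apply/ffunP => i.
  by rewrite ffunE fP.
have [mk|km] := ltnP m k; last first.
  by apply: IH => i mi; have := leq_trans km mi; rewrite leqNgt ltn_ord.
pose i0 := Ordinal mk.
have -> : y = set_arg y i0 (\sum_j coord e j (y i0) *: tnth e j).
  apply/ffunP => i; rewrite ffunE -sum_coord_basis.
  by case: eqP => // ->.
rewrite multilinear_sum_arg big1 // => c _; rewrite IH ?mulr0 // => i mi.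
rewrite ffunE; case: eqP => [_|/eqP ni]; first by exists c.
apply: Hy; rewrite ltn_neqAle mi andbT.
by apply: contraNneq ni => mi'; apply/eqP/val_inj.
Qed.

End AlternatingForms.

(** * The product as a cross product, and its derivations *)

Section Derivations.
Variables (K : fieldType) (V : vectType K) (k : nat) (e : k.+1.-tuple V).
Variable mu : {ffun 'I_k -> V} -> V.
Hypotheses (two_neq0 : (2%:R : K) != 0) (dim_neq2 : (k.+1%:R : K) != 2%:R).
Hypothesis hA : @A_product K V k.+1 e mu.

Let basis_e : basis_of {:V} e.
Proof. by case: hA. Qed.

Definition minor_mx (c : 'I_k.+1) (x : {ffun 'I_k -> V}) : 'M[K]_k :=
  \matrix_(i, l) coord e (lift c l) (x i).

(** Both sides are alternating forms in [x]; they agree when [x] lists all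
    basis vectors but one, hence everywhere. *)
Lemma coord_mu c x :
  coord e c (mu x) = (-1) ^+ (k + c) * \det (minor_mx c x).
Proof.
case: hA => _ mu_lin mu_anti mu_lift.
apply/eqP; rewrite -subr_eq0; apply/eqP.
pose F x := coord e c (mu x) - (-1) ^+ (k + c) * \det (minor_mx c x).
apply: (@alternating_eq0 K V k e two_neq0 basis_e F) => {x} [x i a u v|x i j ij|d].
- rewrite /F mu_lin linearD linearZ /=.
  rewrite (@determinant_multilinear _ _ (minor_mx c (set_arg x i (a *: u + v)))
    (minor_mx c (set_arg x i u)) (minor_mx c (set_arg x i v)) i a 1); first ring.
  + by apply/rowP => l; rewrite !mxE !ffunE eqxx linearD linearZ mul1r.
  + apply/matrixP => r l; rewrite !mxE !ffunE eq_sym.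
    by rewrite (negbTE (neq_lift _ _)).
  + apply/matrixP => r l; rewrite !mxE !ffunE eq_sym.
    by rewrite (negbTE (neq_lift _ _)).
- rewrite /F mu_anti // linearN /=.
  have -> : minor_mx c [ffun l => x (tperm i j l)] = xrow i j (minor_mx c x).
    by apply/matrixP => r l; rewrite !mxE !ffunE.
  by rewrite xrowE det_mulmx det_perm odd_tperm ij expr1; ring.
rewrite /F mu_lift linearZ /= coord_tnth //.
have [->|dc] := eqVneq d c.
  have -> : minor_mx c [ffun j => tnth e (lift c j)] = 1%:M.
    apply/matrixP => r l.
    by rewrite !mxE !ffunE coord_tnth // (inj_eq lift_inj).
  by rewrite det1 !mulr1 addSn addnS !exprS; ring.
(* Row [r], the coordinates of [e_c] other than the one of index [c], is 0. *)
have [r rP _] := unlift_some dc.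
rewrite (expand_det_row _ r) big1 ?mulr0 ?subrr // => l _.
by rewrite !mxE ffunE -rP coord_tnth // (negbTE (neq_lift _ _)) mul0r.
Qed.

Definition dot (u v : V) : K := \sum_j coord e j u * coord e j v.

Lemma dotC u v : dot u v = dot v u.
Proof. by apply: eq_bigr => j _; rewrite mulrC. Qed.

Lemma dotDl u v w : dot (u + v) w = dot u w + dot v w.
Proof.
by rewrite -big_split; apply: eq_bigr => j _; rewrite linearD mulrDl.
Qed.

Lemma dotZl a u w : dot (a *: u) w = a * dot u w.
Proof.
by rewrite big_distrr; apply: eq_bigr => j _; rewrite linearZ /= mulrA.
Qed.

Lemma dotDr u v w : dot w (u + v) = dot w u + dot w v.
Proof. by rewrite dotC dotDl !(dotC w). Qed.

Lemma dot_suml (I : finType) (u : I -> V) w :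
  dot (\sum_i u i) w = \sum_i dot (u i) w.
Proof.
elim/big_rec2: _ => [|i s v _ <-]; last by rewrite dotDl.
by rewrite -(scale0r 0) dotZl mul0r.
Qed.

Lemma dot_tnthr u i : dot u (tnth e i) = coord e i u.
Proof.
rewrite /dot (bigD1 i) //= coord_tnth // eqxx mulr1 big1 ?addr0 // => j ji.
by rewrite coord_tnth // eq_sym (negbTE ji) mulr0.
Qed.

Lemma dot_inj u v : (forall y, dot u y = dot v y) -> u = v.
Proof.
move=> uv; rewrite (sum_coord_basis basis_e u) (sum_coord_basis basis_e v).
by apply: eq_bigr => j _; rewrite -!dot_tnthr uv.
Qed.

Definition rows_mx (x : {ffun 'I_k -> V}) (y : V) : 'M[K]_k.+1 :=
  \matrix_(i, j) coord e j (oapp x y (unlift ord_max i)).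

(** Expansion of the determinant along its last row. *)
Lemma dot_mu x y : dot (mu x) y = \det (rows_mx x y).
Proof.
rewrite (expand_det_row _ ord_max); apply: eq_bigr => j _.
rewrite coord_mu mulrC !mxE unlift_none /cofactor /=.
congr (_ * (_ * \det _)); apply/matrixP => r l.
by rewrite !mxE liftK.
Qed.

Definition trace_of (D : {linear V -> V}) : K :=
  \sum_i dot (D (tnth e i)) (tnth e i).

(** The row identity [sum_det_mulrow] applied to the rows [x_1, ..., x_k, y]. *)
Lemma sum_dot_mu (D : {linear V -> V}) x y :
  \sum_(i < k) dot (mu (set_arg x i (D (x i)))) y + dot (mu x) (D y)
  = trace_of D * dot (mu x) y.
Proof.
pose B : 'M[K]_k.+1 := \matrix_(i, j) coord e j (D (tnth e i)).
have DB v j : coord e j (D v) = \sum_i coord e i v * B i j.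
  rewrite {1}(sum_coord_basis basis_e v) !linear_sum.
  by apply: eq_bigr => i _; rewrite !linearZ mxE.
have -> : trace_of D = \tr B.
  by apply: eq_bigr => i _; rewrite dot_tnthr mxE.
rewrite !dot_mu -sum_det_mulrow (bigD1_ord ord_max) //=.
have mulE a b :
    (rows_mx x y *m B) a b = coord e b (D (oapp x y (unlift ord_max a))).
  by rewrite mxE DB; apply: eq_bigr => i _; rewrite mxE.
rewrite [RHS]addrC; congr (_ + _); last first.
  congr (\det _); apply/matrixP => a b; rewrite mxE [RHS]mxE mulE mxE.
  case: unliftP => [a' ->|->] /=; last by rewrite eqxx.
  by rewrite eq_sym (negbTE (neq_lift _ _)).
apply: eq_bigr => i _; rewrite dot_mu.
congr (\det _); apply/matrixP => a b; rewrite mxE [RHS]mxE mulE mxE.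
case: unliftP => [a' ->|->] /=; last by rewrite (negbTE (neq_lift _ _)).
by rewrite ffunE (inj_eq lift_inj); case: eqP => // ->.
Qed.

(** The derivations are the skew maps, with skewness in the form that tests
    one vector at a time. *)
Lemma derivation_dotP (D : {linear V -> V}) :
  derivation mu D <-> (forall x, dot (D x) x = 0).
Proof.
split=> [derD | skewD].
  have Dmu x y : dot (D (mu x)) y + dot (mu x) (D y)
                 = trace_of D * dot (mu x) y.
    by rewrite -sum_dot_mu derD dot_suml.
  have De i y : dot (D (tnth e i)) y + dot (tnth e i) (D y)
                = trace_of D * dot (tnth e i) y.
    case: hA => _ _ _ mu_lift.
    have := Dmu [ffun j => tnth e (lift i j)] y.
    rewrite mu_lift linearZ !dotZl => h.
    have sgn_neq0 : (-1) ^+ (k.+1 + i.+1) != 0 :> K by rewrite signr_eq0.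
    by apply: (mulfI sgn_neq0); rewrite mulrDr h; ring.
  have tr0 : trace_of D = 0.
    have : 2%:R * trace_of D = k.+1%:R * trace_of D.
      rewrite {1}/trace_of mulr_sumr.
      transitivity (\sum_(i < k.+1) trace_of D); last first.
        by rewrite sumr_const card_ord mulr_natl.
      apply: eq_bigr => i _; have := De i (tnth e i).
      rewrite [dot _ (D _)]dotC -mulr2n mulr_natl => ->.
      by rewrite dot_tnthr coord_tnth // eqxx mulr1.
    move/eqP; rewrite -subr_eq0 -mulrBl mulf_eq0 subr_eq0 eq_sym.
    by rewrite (negbTE dim_neq2) => /eqP.
  move=> x; have : dot (D x) x + dot x (D x) = 0.
    rewrite {1 3}(sum_coord_basis basis_e x) linear_sum !dot_suml -big_split.
    rewrite big1 // => i _; rewrite /= linearZ !dotZl -mulrDr De tr0.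
    by rewrite mul0r mulr0.
  rewrite [dot x _]dotC -mulr2n -mulr_natl => /eqP.
  by rewrite mulf_eq0 (negbTE two_neq0) => /eqP.
have skew u v : dot (D u) v = - dot u (D v).
  have := skewD (u + v); rewrite linearD dotDl !dotDr !skewD add0r addr0.
  by rewrite [dot (D v) u]dotC => /eqP; rewrite addr_eq0 => /eqP.
have tr0 : trace_of D = 0 by rewrite /trace_of big1.
move=> x; apply: dot_inj => y; rewrite skew dot_suml.
by have /eqP := sum_dot_mu D x y; rewrite tr0 mul0r addr_eq0 => /eqP ->.
Qed.

End Derivations.

Theorem theorem4 (R : realType) (n : nat) (hn : (4 <= n)%N)
    (V : vectType R[i]) (e : n.-tuple V) (mu : {ffun 'I_n.-1 -> V} -> V)
    (hA : A_product e mu) (N : {linear V -> V}) :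
  local_derivation mu N -> derivation mu N.
Proof.
case: n => [|k] // in hn e mu hA *.
move=> locN.
have two_neq0 : (2%:R : R[i]) != 0 by rewrite Num.Theory.pnatr_eq0.
have dim_neq2 : (k.+1%:R : R[i]) != 2%:R.
  by rewrite Num.Theory.eqr_nat; case: k hn {e mu hA N locN} => [|[|]].
apply/(derivation_dotP two_neq0 dim_neq2 hA) => x.
have [D derD ->] := locN x.
by move/(derivation_dotP two_neq0 dim_neq2 hA): derD; apply.
Qed.
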